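(* Let $A$ be an octonion algebra over a field $F$, let $f(x)$ be a quadratic monic polynomial in $A[x]$, and let $\alpha\in A$ satisfy $f(\alpha)=\alpha$. Then $\alpha$ is a fixed point of $f(x)$, i.e. $f^{\circ n}(\alpha)=\alpha$ for every $n\in\mathbb N$ (here $n\ge 1$).
   Context: Octonion algebras: let $Q$ be a quaternion algebra over a field $F$ with canonical involution $z\mapsto\overline z$, and let $\gamma\in F^\times$. The octonion algebra $A=Q\oplus Q\ell$ has multiplication $(q+r\ell)(s+t\ell)=qs+\gamma\overline{t}r+(tq+r\overline{s})\ell$ for $q,r,s,t\in Q$. Polynomials: $A[x]=A\otimes_F F[x]$, so $x$ is central. For $f(x)=a_mx^m+\dots+a_1x+a_0\in A[x]$ and $\alpha\in A$, the substitution is $f(\alpha)=a_m\alpha^m+\dots+a_1\alpha+a_0$ (coefficients on the left); substitution is not a ring homomorphism. Composition of polynomials is $f\circ g(x)=a_m(g(x))^m+\dots+a_1g(x)+a_0$, computed in $A[x]$, and $f^{\circ n}(x)$ is defined recursively by $f^{\circ 1}(x)=f(x)$ and $f^{\circ n}(x)=f\circ f^{\circ(n-1)}(x)$; $f^{\circ n}(\alpha)$ denotes substitution of $\alpha$ into the polynomial $f^{\circ n}(x)$. An element $\alpha$ is called a fixed point of $f(x)$ if $f^{\circ n}(\alpha)=\alpha$ for every $n\in\mathbb N$. A quadratic monic polynomial is one of the form $x^2+Bx+C$ with $B,C\in A$. *)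

(* Defs.v *)
From HB Require Import structures.
From mathcomp Require Import all_boot all_order all_algebra all_field.
From mathcomp Require Import finmap monalg.

Set Implicit Arguments.
Unset Strict Implicit.
Unset Printing Implicit Defensive.

Import GRing.Theory.

Local Open Scope ring_scope.

(* A quaternion algebra is a central simple algebra of dimension 4.  Two-sided
   ideals of a unital F-algebra are F-subspaces, so {vspace Q} captures them
   all. *)
Definition quaternion_algebra (F : fieldType) (Q : falgType F) : Prop :=
  [/\ \dim {:Q} = 4%N,
      'Z({:Q})%VS = 1%VS :> {vspace Q}
    & forall I : {vspace Q},
        ({:Q} * I <= I)%VS -> (I * {:Q} <= I)%VS -> I = 0%VS \/ I = fullv].

(* The existence of a scalar trace and a scalar norm singles out the canonical
   involution among the F-linear involutions of a quaternion algebra. *)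
Definition canonical_involution (F : fieldType) (Q : falgType F)
    (bar : Q -> Q) : Prop :=
  [/\ linear bar,
      forall z w, bar (z * w) = bar w * bar z,
      involutive bar,
      forall z, exists t : F, z + bar z = t%:A
    & forall z, exists n : F, z * bar z = n%:A].

Section Octonion.

Context (F : fieldType) (Q : falgType F).

(* (q, r) stands for q + r l; addition and scaling are those of the product. *)
Definition octonion := (Q * Q)%type.

Definition octonion_one : octonion := (1, 0).

Definition octonion_mul (bar : Q -> Q) (gamma : F) (u v : octonion) :
    octonion :=
  let: (q, r) := u in let: (s, t) := v in
  (q * s + gamma *: (bar t * r), t * q + r * bar s).

End Octonion.

(* MathComp's {poly A} requires an associative A.  For a zmodType A with an
   arbitrary product, A[x] is {malg A[nat]}, the finitely supported functions
   nat -> A, and << a *g i >> is the monomial a x^i. *)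
Section NonassociativePolynomials.

Context (A : zmodType) (mul : A -> A -> A) (one : A).

Local Notation poly := {malg A[nat]}.

Definition nonassoc_pow (a : A) (n : nat) : A := iter n (mul^~ a) one.

Definition poly_mul (f g : poly) : poly :=
  \sum_(i <- msupp f) \sum_(j <- msupp g) << mul f@_i g@_j *g (i + j)%N >>.

Definition poly_pow (f : poly) (n : nat) : poly :=
  iter n (poly_mul^~ f) << one *g 0%N >>.

Definition poly_subst (f : poly) (a : A) : A :=
  \sum_(i <- msupp f) mul f@_i (nonassoc_pow a i).

Definition poly_comp (f g : poly) : poly :=
  \sum_(i <- msupp f) poly_mul << f@_i *g 0%N >> (poly_pow g i).

(* Meaningful for n >= 1 only: poly_iter f 0 is the junk value f. *)
Definition poly_iter (f : poly) (n : nat) : poly := iter n.-1 (poly_comp f) f.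

Definition poly_fixed_point (f : poly) (a : A) : Prop :=
  forall n : nat, (0 < n)%N -> poly_subst (poly_iter f n) a = a.

Definition quadratic_monic (f : poly) : Prop :=
  exists B C : A, f = << one *g 2%N >> + << B *g 1%N >> + << C *g 0%N >>.

End NonassociativePolynomials.

(* Main.v *)
Require Import Defs.
From mathcomp Require Import all_boot all_order all_algebra all_field.
From mathcomp Require Import finmap monalg.

(* In an associative algebra, g(a) = a implies (h g)(a) = h(a) a, hence
   (f o g)(a) = f(a), and the theorem follows by induction on n.  Octonions are
   not associative, but the equation f(a) = a expresses C as a - a^2 - B a, so
   all the coefficients involved lie in the subalgebra generated by a and B.
   This subalgebra is associative by Artin's theorem; as every octonion
   satisfies a quadratic equation, it is simply the span of 1, a, B, a B. *)

Set Implicit Arguments.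
Unset Strict Implicit.
Unset Printing Implicit Defensive.

Import GRing.Theory.

Local Open Scope ring_scope.

(** * Finite sums under a distributive, possibly non-associative product *)

Section DistributiveMul.

Context (A : zmodType) (mul : A -> A -> A).
Context (mulDl : left_distributive mul +%R).
Context (mulDr : right_distributive mul +%R).

Lemma dist_mul0l b : mul 0 b = 0.
Proof. by apply: (addrI (mul 0 b)); rewrite -mulDl !addr0. Qed.

Lemma dist_mul0r a : mul a 0 = 0.
Proof. by apply: (addrI (mul a 0)); rewrite -mulDr !addr0. Qed.

Lemma mul_suml (I : Type) (s : seq I) (P : pred I) (G : I -> A) b :
  mul (\sum_(i <- s | P i) G i) b = \sum_(i <- s | P i) mul (G i) b.
Proof.
exact: (big_morph (mul^~ b) (fun x y => mulDl x y b) (dist_mul0l b)).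
Qed.

Lemma mul_sumr (I : Type) (s : seq I) (P : pred I) (G : I -> A) a :
  mul a (\sum_(i <- s | P i) G i) = \sum_(i <- s | P i) mul a (G i).
Proof. exact: (big_morph (mul a) (mulDr a) (dist_mul0r a)). Qed.

End DistributiveMul.

(** * Substitution into polynomials whose coefficients lie in an associative subset *)

Section Substitution.

Context (A : zmodType) (mul : A -> A -> A) (one : A).
Context (mulDl : left_distributive mul +%R).
Context (mulDr : right_distributive mul +%R).
Context (mul1l : left_id one mul) (mul1r : right_id one mul).

Local Notation poly := {malg A[nat]}.
Local Notation pow := (nonassoc_pow mul one).
Local Notation subst := (poly_subst mul one).

Lemma poly_substEw (d : {fset nat}) (f : poly) a :
  (msupp f `<=` d)%fset -> subst f a = \sum_(i <- d) mul f@_i (pow a i).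
Proof.
move=> le_fd; apply: big_fset_incl => // i _ /mcoeff_outdom ->.
exact: dist_mul0l.
Qed.

Lemma poly_substD a : {morph subst^~ a : f g / f + g}.
Proof.
move=> f g; pose d := (msupp f `|` msupp g)%fset.
rewrite (@poly_substEw d (f + g)) ?msuppD_le //.
rewrite (@poly_substEw d f) ?fsubsetUl // (@poly_substEw d g) ?fsubsetUr //.
by rewrite -big_split; apply: eq_bigr => i _; rewrite mcoeffD mulDl.
Qed.

Lemma poly_subst0 a : subst 0 a = 0.
Proof. by rewrite /poly_subst msupp0 big_seq_fset0. Qed.

Lemma poly_subst_sum (I : Type) (s : seq I) (G : I -> poly) a :
  subst (\sum_(i <- s) G i) a = \sum_(i <- s) subst (G i) a.
Proof. exact: (big_morph (subst^~ a) (poly_substD a) (poly_subst0 a)). Qed.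

Lemma poly_substU c i a : subst << c *g i >> a = mul c (pow a i).
Proof.
by rewrite (poly_substEw _ (msuppU_le (k := i))) big_seq_fset1 mcoeffUU.
Qed.

(** [S] plays the role of the associative subalgebra that contains the point and all coefficients;
    products are reassociated only inside it. *)
Context (S : A -> Prop).
Context (S1 : S one) (S0 : S 0).
Context (SD : forall u v, S u -> S v -> S (u + v)).
Context (SM : forall u v, S u -> S v -> S (mul u v)).
Context (SA : forall u v w, S u -> S v -> S w ->
  mul u (mul v w) = mul (mul u v) w).

Definition coefs_in (f : poly) : Prop := forall i, S f@_i.

Lemma coefs_in_sum (I : Type) (s : seq I) (G : I -> poly) :
  (forall i, coefs_in (G i)) -> coefs_in (\sum_(i <- s) G i).
Proof.
move=> SG j; elim: s => [|i s IHs]; first by rewrite big_nil mcoeff0.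
by rewrite big_cons mcoeffD; apply: SD IHs; apply: SG.
Qed.

Lemma coefs_inU c i : S c -> coefs_in << c *g i >>.
Proof. by move=> Sc j; rewrite mcoeffU mulrb; case: ifP. Qed.

Lemma coefs_in_mul f g : coefs_in f -> coefs_in g ->
  coefs_in (poly_mul mul f g).
Proof.
move=> Sf Sg; apply: coefs_in_sum => i; apply: coefs_in_sum => j.
by apply: coefs_inU; apply: SM.
Qed.

Lemma coefs_in_pow g n : coefs_in g -> coefs_in (poly_pow mul one g n).
Proof.
move=> Sg; elim: n => [|n IHn]; first exact: coefs_inU.
exact: coefs_in_mul.
Qed.

Lemma coefs_in_comp f g : coefs_in f -> coefs_in g ->
  coefs_in (poly_comp mul one f g).
Proof.
move=> Sf Sg; apply: coefs_in_sum => i.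
by apply: coefs_in_mul; [apply: coefs_inU | apply: coefs_in_pow].
Qed.

Section Point.

Context (a : A) (Sa : S a).

Lemma pow_in n : S (pow a n).
Proof. by elim: n => [|n IHn] //=; apply: SM. Qed.

Lemma powD i j : pow a (i + j) = mul (pow a i) (pow a j).
Proof.
elim: j => [|j IHj]; first by rewrite addn0 mul1r.
by rewrite addnS /= IHj -SA //; apply: pow_in.
Qed.

(** Since x is central, the (i, j) term contributes (f_i g_j) a^(i+j). Writing a^(i+j) as a^j a^i
    puts a^j next to g_j, and the sum over j then collects into g(a), between f_i and a^i. *)
Lemma poly_subst_mul f g : coefs_in f -> coefs_in g ->
  subst (poly_mul mul f g) a
    = \sum_(i <- msupp f) mul (mul f@_i (subst g a)) (pow a i).
Proof.
move=> Sf Sg; rewrite poly_subst_sum; apply: eq_bigr => i _.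
rewrite poly_subst_sum mul_sumr // mul_suml //; apply: eq_bigr => j _.
by rewrite poly_substU addnC powD !SA //;
   do ?[apply: SM => //]; apply: pow_in.
Qed.

(** Once g(a) = a, the middle factor commutes with a^i, so it can be moved to the far right and
    pulled out of the sum. *)
Lemma poly_subst_mul_fixed f g : coefs_in f -> coefs_in g ->
  subst g a = a -> subst (poly_mul mul f g) a = mul (subst f a) a.
Proof.
move=> Sf Sg ga; rewrite poly_subst_mul // ga mul_suml //.
apply: eq_bigr => i _; have Spow := pow_in i.
have -> : mul (mul f@_i a) (pow a i) = mul f@_i (mul a (pow a i)).
  by rewrite SA.
have -> : mul a (pow a i) = pow a (1 + i) by rewrite powD /= mul1l.
by rewrite addnC powD /= mul1l SA.
Qed.

Lemma poly_subst_pow_fixed g n : coefs_in g -> subst g a = a ->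
  subst (poly_pow mul one g n) a = pow a n.
Proof.
move=> Sg ga; elim: n => [|n IHn]; first by rewrite poly_substU mul1l.
by rewrite /= poly_subst_mul_fixed ?IHn //; apply: coefs_in_pow.
Qed.

(** Each summand of the composition is a constant times g^i. The constant contributes only the power
    a^0, and g^i takes the value a^i at a. *)
Lemma poly_subst_comp_fixed f g : coefs_in f -> coefs_in g ->
  subst g a = a -> subst (poly_comp mul one f g) a = subst f a.
Proof.
move=> Sf Sg ga; rewrite poly_subst_sum; apply: eq_bigr => i _.
have Sgi := coefs_in_pow i Sg.
rewrite poly_subst_mul //; last exact: coefs_inU.
(* The support of a constant polynomial is empty when the constant is 0, so the sum is first
   extended to the index set {0}. *)
rewrite poly_subst_pow_fixed // (@big_fset_incl _ _ _ _ _ [fset 0%N]%fset).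
- by rewrite big_seq_fset1 mcoeffUU mul1r.
- exact: msuppU_le.
- by move=> j _ /mcoeff_outdom ->; rewrite !dist_mul0l.
Qed.

Lemma poly_fixed_point_in f : coefs_in f -> subst f a = a ->
  poly_fixed_point mul one f a.
Proof.
(* The first iterate is f itself, so the induction runs on the number [n.-1] of compositions; the
   inner induction keeps the coefficients of the iterates in [S]. *)
move=> Sf fa n _; rewrite /poly_iter; elim: n.-1 => [|m IHm] //=.
rewrite poly_subst_comp_fixed //.
by elim: m {IHm} => [|m IHm] //=; apply: coefs_in_comp.
Qed.

End Point.

End Substitution.

(** * Artin's theorem for quadratic alternative algebras *)

Section QuadraticAlternative.

Context (F : fieldType) (A : lmodType F) (mul : A -> A -> A) (one : A).
Context (mulDl : left_distributive mul +%R).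
Context (mulDr : right_distributive mul +%R).
Context (mulZl : forall c u v, mul (c *: u) v = c *: mul u v).
Context (mulZr : forall c u v, mul u (c *: v) = c *: mul u v).
Context (mul1l : left_id one mul) (mul1r : right_id one mul).
Context (altl : forall u v, mul u (mul u v) = mul (mul u u) v).
Context (altr : forall u v, mul v (mul u u) = mul (mul v u) u).
Context (quad : forall u, exists t n : F, mul u u = t *: u + n *: one).

Definition associates u v w : Prop := mul u (mul v w) = mul (mul u v) w.

(** Linearizing the left alternative law at u + v shows that the associator changes sign under this
    swap. With the analogous swap of the last two entries, associativity of a triple does not depend
    on its order. *)
Lemma associates_flip12 u v w : associates u v w -> associates v u w.
Proof.
move=> uvw; have := altl (u + v) w.
by rewrite !(mulDl, mulDr) -!altl uvw => /addrI /addIr.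
Qed.

Lemma associates_flip23 u v w : associates u v w -> associates u w v.
Proof.
move=> uvw; have := altr (v + w) u.
by rewrite !(mulDr, mulDl) -!altr uvw => /addIr /addrI.
Qed.

Lemma flexible u v : associates u v u.
Proof. exact/associates_flip23/altl. Qed.

Inductive span (P : A -> Prop) : A -> Prop :=
  | span_gen u : P u -> span P u
  | span0 : span P 0
  | spanD u v : span P u -> span P v -> span P (u + v)
  | spanZ c u : span P u -> span P (c *: u).

Lemma span_mul P : (forall u v, P u -> P v -> span P (mul u v)) ->
  forall u v, span P u -> span P v -> span P (mul u v).
Proof.
move=> Pmul u v Su; move: v.
elim: {u}Su => [u Pu||u u' _ IHu _ IHu'|c u _ IHu] v Sv.
- elim: {v}Sv => [v||v v' _ IHv _ IHv'|c v _ IHv].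
  + exact: Pmul.
  + by rewrite dist_mul0r //; apply: span0.
  + by rewrite mulDr; apply: spanD.
  + by rewrite mulZr; apply: spanZ.
- by rewrite dist_mul0l //; apply: span0.
- by rewrite mulDl; apply: spanD; [apply: IHu | apply: IHu'].
- by rewrite mulZl; apply: spanZ; apply: IHu.
Qed.

(** The associator is trilinear, so its vanishing is checked on generators, one argument at a
    time. *)
Lemma span_associates P :
  (forall u v w, P u -> P v -> P w -> associates u v w) ->
  forall u v w, span P u -> span P v -> span P w -> associates u v w.
Proof.
rewrite /associates => PA u v w Su Sv Sw.
elim: {u}Su => [u Pu||u u' _ IHu _ IHu'|c u _ IHu]; last 3 first.
- by rewrite !dist_mul0l.
- by rewrite !mulDl IHu IHu'.
- by rewrite !mulZl IHu.
elim: {v}Sv => [v Pv||v v' _ IHv _ IHv'|c v _ IHv]; last 3 first.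
- by rewrite dist_mul0l // dist_mul0r // dist_mul0l.
- by rewrite mulDl !mulDr mulDl IHv IHv'.
- by rewrite mulZl !mulZr mulZl IHv.
elim: {w}Sw => [w Pw||w w' _ IHw _ IHw'|c w _ IHw]; last 3 first.
- by rewrite !dist_mul0r.
- by rewrite !mulDr IHw IHw'.
- by rewrite !mulZr IHw.
exact: PA.
Qed.

Section TwoGenerators.

Context (a b : A).

Definition basis2 (u : A) : Prop :=
  [\/ u = one, u = a, u = b | u = mul a b].

(** Triples containing 1 are trivial, and those with a repeated entry follow from the alternative
    and flexible laws. What remains are the six orderings of a, b, ab, all obtained by swaps from a
    single one. *)
Lemma basis2_associates u v w :
  basis2 u -> basis2 v -> basis2 w -> associates u v w.
Proof.
have assoc1l x y : associates one x y by rewrite /associates !mul1l.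
have assoc1m x y : associates x one y by rewrite /associates mul1l mul1r.
have assoc1r x y : associates x y one by rewrite /associates !mul1r.
(* Both sides equal (aa)(bb). *)
have aabb : associates a (mul a b) b.
  by rewrite /associates -altr !altl -altr.
have aab_b : associates (mul a b) a b by exact: associates_flip12.
have abab : associates a b (mul a b) by exact: associates_flip23.
have baba : associates b a (mul a b) by exact: associates_flip12.
have baab : associates b (mul a b) a by exact: associates_flip23.
have abba : associates (mul a b) b a by exact: associates_flip23.
have eql x y : associates x x y by exact: altl.
have eqr x y : associates x y y by exact: altr.
have flex := flexible.
by case=> ->; case=> ->; case=> ->.
Qed.

(** The quadratic equation handles squares. Left multiplication by a and right multiplication by b
    preserve the span because a(ab) = (aa)b and (ab)b = a(bb), where the squares reduce again. *)
Lemma basis2_mul u v : basis2 u -> basis2 v -> span basis2 (mul u v).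
Proof.
have g1 : span basis2 one by apply/span_gen/Or41.
have ga : span basis2 a by apply/span_gen/Or42.
have gb : span basis2 b by apply/span_gen/Or43.
have gab : span basis2 (mul a b) by apply/span_gen/Or44.
have sqr x : span basis2 x -> span basis2 (mul x x).
  by have [t [n ->]] := quad x => Sx; apply: spanD; apply: spanZ.
have lmula x : span basis2 x -> span basis2 (mul a x).
  elim=> [y [] ->||y y' _ IH _ IH'|c y _ IH]; rewrite ?mul1r //.
  - exact: sqr.
  - rewrite altl; have [t [n ->]] := quad a.
    by rewrite mulDl !mulZl mul1l; apply: spanD; apply: spanZ.
  - by rewrite dist_mul0r //; apply: span0.
  - by rewrite mulDr; apply: spanD.
  - by rewrite mulZr; apply: spanZ.
have rmulb x : span basis2 x -> span basis2 (mul x b).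
  elim=> [y [] ->||y y' _ IH _ IH'|c y _ IH]; rewrite ?mul1l //.
  - exact: sqr.
  - rewrite -altr; have [t [n ->]] := quad b.
    by rewrite mulDr !mulZr mul1r; apply: spanD; apply: spanZ.
  - by rewrite dist_mul0l //; apply: span0.
  - by rewrite mulDl; apply: spanD.
  - by rewrite mulZl; apply: spanZ.
have gba : span basis2 (mul b a).
  (* Expanding the square of a + b expresses ba through ab and squares. *)
  have -> : mul b a = mul (a + b) (a + b)
      + -1 *: (mul a b + mul b b) + -1 *: mul a a.
    by rewrite mulDr !mulDl !scaleN1r addrK addrC addKr.
  by do ?[done | apply: spanZ | apply: spanD | apply: sqr].
case=> ->; case=> ->; rewrite ?mul1l ?mul1r //;
  do ?[exact: sqr | exact: lmula | exact: rmulb].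
(* The two products left are b(ab) = (ba)b and (ab)a = a(ba). *)
- by rewrite flexible; apply: rmulb.
- by rewrite -flexible; apply: lmula.
Qed.

Lemma artin_quadratic : let S := span basis2 in
  [/\ forall u v, S u -> S v -> S (mul u v)
    & forall u v w, S u -> S v -> S w -> mul u (mul v w) = mul (mul u v) w].
Proof.
split; first exact: span_mul basis2_mul.
exact: span_associates basis2_associates.
Qed.

End TwoGenerators.

End QuadraticAlternative.

(** * Octonions form a quadratic alternative algebra *)

Section OctonionAlgebra.

Context (F : fieldType) (Q : falgType F) (bar : Q -> Q) (gamma : F).
Context (hbar : canonical_involution bar).

Local Notation mul := (octonion_mul bar gamma).
Local Notation one := (octonion_one Q).

Lemma barD : {morph bar : z w / z + w}.
Proof.
by case: hbar => bar_lin _ _ _ _ z w; rewrite -[z]scale1r bar_lin !scale1r.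
Qed.

Lemma bar0 : bar 0 = 0.
Proof. by apply: (addrI (bar 0)); rewrite -barD !addr0. Qed.

Lemma barZ c z : bar (c *: z) = c *: bar z.
Proof.
by case: hbar => bar_lin _ _ _ _; rewrite -[c *: z]addr0 bar_lin bar0 addr0.
Qed.

Lemma barM z w : bar (z * w) = bar w * bar z.
Proof. by case: hbar. Qed.

Lemma barK : involutive bar.
Proof. by case: hbar. Qed.

Lemma bar1 : bar 1 = 1.
Proof. by rewrite -[RHS]barK -[bar 1 in RHS]mul1r barM barK mul1r. Qed.

Lemma bar_trace z : exists t : F,
  (forall w, w * z + w * bar z = t *: w) /\
  (forall w, z * w + bar z * w = t *: w).
Proof.
case: hbar => _ _ _ trP _; have [t zt] := trP z; exists t; split=> w.
  by rewrite -mulrDr zt -scalerAr mulr1.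
by rewrite -mulrDl zt -scalerAl mul1r.
Qed.

(** As bar z is a scalar minus z, it commutes with z, so one scalar serves both orders. *)
Lemma bar_norm z : exists n : F, z * bar z = n%:A /\ bar z * z = n%:A.
Proof.
case: hbar => _ _ _ trP nmP; have [n zn] := nmP z; exists n; split=> //.
have [t zt] := trP z; rewrite -zn -[bar z](addKr z) zt.
by rewrite mulrDr mulrDl mulNr mulrN -scalerAr -scalerAl mulr1 mul1r.
Qed.

Lemma octonion_mulE u v : mul u v =
  (u.1 * v.1 + gamma *: (bar v.2 * u.2), v.2 * u.1 + u.2 * bar v.1).
Proof. by case: u v => [q r] [s t]. Qed.

Lemma octonion_mulDl : left_distributive mul +%R.
Proof.
move=> u v w; rewrite !octonion_mulE; congr pair => /=.
  by rewrite mulrDl mulrDr scalerDr addrACA.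
by rewrite mulrDr mulrDl addrACA.
Qed.

Lemma octonion_mulDr : right_distributive mul +%R.
Proof.
move=> u v w; rewrite !octonion_mulE; congr pair => /=; rewrite barD.
  by rewrite mulrDl mulrDr scalerDr addrACA.
by rewrite mulrDr mulrDl addrACA.
Qed.

Lemma octonion_mulZl c u v : mul (c *: u) v = c *: mul u v.
Proof.
rewrite !octonion_mulE; congr pair => /=.
  by rewrite -scalerAl -scalerAr scalerA mulrC -scalerA -scalerDr.
by rewrite -scalerAl -scalerAr -scalerDr.
Qed.

Lemma octonion_mulZr c u v : mul u (c *: v) = c *: mul u v.
Proof.
rewrite !octonion_mulE; congr pair => /=; rewrite barZ.
  by rewrite -scalerAl -scalerAr scalerA mulrC -scalerA -scalerDr.
by rewrite -scalerAl -scalerAr -scalerDr.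
Qed.

Lemma octonion_mul1l : left_id one mul.
Proof.
case=> q r; rewrite octonion_mulE /octonion_one /=.
by rewrite mulr0 scaler0 mul0r !addr0 mul1r mulr1.
Qed.

Lemma octonion_mul1r : right_id one mul.
Proof.
case=> q r; rewrite octonion_mulE /octonion_one /= bar0 bar1.
by rewrite !mul0r scaler0 addr0 add0r !mulr1.
Qed.

(** For u = q + r l, the square has l-part tr(q) r, and bar r * r is a scalar. In each component the
    terms pair up into q + bar q or a norm of r, and these scalars move freely through the
    associative product of Q. *)
Lemma octonion_altl u v : mul u (mul u v) = mul (mul u u) v.
Proof.
case: u v => [q r] [s t]; rewrite !octonion_mulE /=.
have [n [rr' r'r]] := bar_norm r; have [k [trr trl]] := bar_trace q.
rewrite trr r'r !barD !barZ !barM !barK; congr pair.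
  rewrite !mulrDr !mulrDl !scalerDr -!scalerAr -!scalerAl -!mulrA r'r.
  rewrite mul1r -trl scalerDr -scalerAr mulr1 -!addrA; congr (_ + _).
  by rewrite addrA addrC.
rewrite -scalerAl scalerAr -trr !mulrDl !mulrDr -!scalerAr !mulrA rr'.
rewrite -scalerAl mul1r mulr1 -!addrA; congr (_ + _).
by rewrite addrA addrC.
Qed.

Lemma octonion_altr u v : mul v (mul u u) = mul (mul v u) u.
Proof.
case: u v => [q r] [s t]; rewrite !octonion_mulE /=.
have [n [rr' r'r]] := bar_norm r; have [k [trr trl]] := bar_trace q.
rewrite trr r'r !barD !barZ !barM bar1; congr pair.
  rewrite -scalerAl -trr !mulrDr !mulrDl !scalerDr.
  rewrite -!scalerAr -!scalerAl !mulrA r'r.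
  rewrite mulr1 -scalerAl mul1r -!addrA; congr (_ + _).
  by rewrite addrCA.
rewrite -scalerAl -trr !mulrDr !mulrDl -!scalerAr !mulrA rr'.
rewrite mulr1 -scalerAl mul1r. rewrite -!addrA; congr (_ + _).
by rewrite addrA addrC.
Qed.

Lemma octonion_quad u : exists t n : F, mul u u = t *: u + n *: one.
Proof.
case: u => [q r]; rewrite octonion_mulE /=.
have [n [_ r'r]] := bar_norm r; have [m [qq' _]] := bar_norm q.
have [k [trr _]] := bar_trace q.
(* These are the trace of q + r l, which is that of q, and minus its norm n(q) - gamma n(r). *)
exists k, (gamma * n - m); rewrite trr r'r; congr pair => /=.
  by rewrite -trr scalerBl -scalerA -qq' [_ - _]addrC addrA addrK.
by rewrite scaler0 addr0.
Qed.

End OctonionAlgebra.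

Theorem corollary4p2 (F : fieldType) (Q : falgType F) (bar : Q -> Q) (gamma : F)
    (hQ : quaternion_algebra Q) (hbar : canonical_involution bar)
    (hgamma : gamma != 0)
    (f : {malg (octonion Q)[nat]}) (hf : quadratic_monic (octonion_one Q) f)
    (alpha : octonion Q)
    (halpha : poly_subst (octonion_mul bar gamma) (octonion_one Q) f alpha = alpha) :
  poly_fixed_point (octonion_mul bar gamma) (octonion_one Q) f alpha.
Proof.
have mulDl := octonion_mulDl bar gamma; have mulDr := octonion_mulDr gamma hbar.
have mul1l := octonion_mul1l bar gamma; have mul1r := octonion_mul1r gamma hbar.
have [B [C def_f]] := hf.
have [SM SA] := artin_quadratic mulDl mulDr (octonion_mulZl bar gamma)
  (octonion_mulZr gamma hbar) mul1l mul1r (octonion_altl gamma hbar)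
  (octonion_altr gamma hbar) (octonion_quad gamma hbar) alpha B.
set S := span _ in SM SA.
have S1 : S (octonion_one Q) by apply/span_gen/Or41.
have Sa : S alpha by apply/span_gen/Or42.
have SB : S B by apply/span_gen/Or43.
have SC : S C.
  have <- : alpha + -1 *: (octonion_mul bar gamma alpha alpha
      + octonion_mul bar gamma B alpha) = C.
    (* Only the leading alpha is replaced by f(alpha); subtracting the two higher terms then leaves
       C. *)
    rewrite -{1}halpha def_f !poly_substD // !poly_substU //.
    rewrite /nonassoc_pow !iterS [iter 0 _ _]/= !mul1l mul1r.
    by rewrite scaleN1r addrC addKr.
  by apply: spanD => //; apply: spanZ; apply: spanD; apply: SM.
apply: (@poly_fixed_point_in _ _ _ mulDl mulDr mul1l mul1r S) => //.
- exact: span0.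
- exact: spanD.
- move=> i; rewrite def_f !mcoeffD !mcoeffU !mulrb.
  by do 2?apply: spanD; case: ifP => _ //; apply: span0.
Qed.
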